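(* Let $B,\bar B$ be real or complex vector spaces and $L(\varepsilon)=\sum_{i=0}^\infty\varepsilon^iL_i$ a formal power series with $L_i\in L(B,\bar B)$, $L(\varepsilon)\not\equiv0$. Then the recursion of the context is well defined at every stage $k+1$, $k\ge0$, and for any choice of complements the following hold. (i) For every $k\ge0$, the kernel of $\Delta^{k+1}\in L(B^{k+1},\bar B^{k+1})$ is the range of $M^{(k+1)}\in L(B^{k+1},B^{k+1})$ restricted to $N_1\times\cdots\times N_{k+1}$: $$N[\Delta^{k+1}]=R\big[M^{(k+1)}|_{N_1\times\cdots\times N_{k+1}}\big]=\begin{pmatrix} I_B \\ 0 \\ 0 \\ \vdots \\ 0 \end{pmatrix}N_1\oplus\begin{pmatrix} M_{1,2} \\ I_B \\ 0 \\ \vdots \\ 0 \end{pmatrix}N_2\oplus\cdots\oplus\begin{pmatrix} M_{1,k+1} \\ M_{2,k+1} \\ \vdots \\ M_{k,k+1} \\ I_B \end{pmatrix}N_{k+1}.$$ (ii) For every $k\ge0$ and $b_0\in B$: $\mathrm{rank}(b_0)\ge k\Leftrightarrow b_0\in N_k$; $\mathrm{rank}(b_0)=k\Leftrightarrow b_0\in N_k\setminus N_{k+1}$; and $\mathrm{rank}(b_0)=k$ whenever $b_0\in N_{k+1}^c\subset N_k$, $b_0\ne0$. (iii) For every $k\ge0$, stabilization of $L(\varepsilon)$ at $k$ is equivalent to each of the following conditions: - $N_{k+1}^c\ne\{0\}$ and $N_{k+l}^c=\{0\}$ for all $l\ge2$; - $R_{k+1}\ne\{0\}$ and $R_{k+l}=\{0\}$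 for all $l\ge2$; - $N_k\supsetneq N_{k+1}=N_{k+l}$ for all $l\ge2$.
   Context: $L(X,Y)$ denotes the linear maps from $X$ to $Y$; $N[T]$ and $R[T]$ are the kernel and range of $T$; $I_X$ is the identity. Rank and stabilization. For $k\ge1$ let $\Delta^k:B^k\to\bar B^k$ be the upper triangular block Toeplitz operator with $(i,j)$ entry $L_{j-i}$ for $j\ge i$ and $0$ otherwise, so that $\Delta^k(b_{k-1},\dots,b_0)^T=0$ iff $\sum_{i+j=m}L_ib_j=0$ for $m=0,\dots,k-1$. For $b_0\in B$ put $\mathrm{rank}(b_0)=0$ if $b_0\notin N[L_0]$, and otherwise $\mathrm{rank}(b_0)=\sup\{k\ge1\mid\exists (b_{k-1},\dots,b_0)\in B^k:\ \Delta^k(b_{k-1},\dots,b_0)^T=0\}\in\mathbb{N}\cup\{\infty\}$. $L(\varepsilon)$ stabilizes at $k\ge0$ if $\mathrm{rank}(b_0)\in\{0,\dots,k\}\cup\{\infty\}$ for all $b_0\in B$ and there exists $b_0$ with $\mathrm{rank}(b_0)=k$. Recursion. Put $N_0:=B$, $N_0^c:=\{0\}$, $R_0:=\{0\}$, $R_0^c:=\bar B$, $\bar S_1:=S_1:=L_0$, $E_{1,1}:=M_{1,1}:=I_B$. At each stage $j\ge1$, given $S_j\in L(B,R_{j-1}^c)$, set $N_j:=\{n\in N_{j-1}\mid S_jn=0\}$, $R_j:=S_j(N_{j-1})$ and choose algebraic direct complements $N_{j-1}=N_j^c\oplus N_j$, $R_{j-1}^c=R_j\oplus R_j^c$. Then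 $B=N_1^c\oplus\cdots\oplus N_j^c\oplus N_j$ and $\bar B=R_1\oplus\cdots\oplus R_j\oplus R_j^c$; $\mathcal P_j$ denotes the projection of $\bar B$ onto $R_j$ defined by the latter decomposition, and $S_j^{-1}:R_j\to N_j^c$ denotes the inverse of the bijection $S_j|_{N_j^c}:N_j^c\to R_j$. At stage $j\ge2$, the operators are defined by $$\bar S_j:=\sum_{i=1}^{j-1}L_iM_{i,j-1},\qquad S_j:=(I_{\bar B}-\mathcal P_1-\cdots-\mathcal P_{j-1})\bar S_j,$$ $$E_{j,j}:=I_B,\qquad E_{i,j}:=-S_i^{-1}\mathcal P_i\sum_{\nu=i+1}^{j}\bar S_\nu E_{\nu,j}\quad (i=j-1,\dots,1),$$ $$M_{1,j}:=E_{1,j},\qquad M_{i,j}:=\sum_{\nu=i}^{j}M_{i-1,\nu-1}E_{\nu,j}\quad(i=2,\dots,j).$$ (So $M_{j,j}=I_B$.) $M^{(k+1)}$ is the upper triangular $(k+1)\times(k+1)$ operator matrix with entries $M_{i,j}$ for $i\le j$ and $0$ for $i>j$. *)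

(* Defs.v *)
From HB Require Import structures.
From mathcomp Require Import all_boot all_order all_algebra.
From mathcomp Require Import complex.
From mathcomp Require Import all_classical all_reals ereal.

Set Implicit Arguments.
Unset Strict Implicit.
Unset Printing Implicit Defensive.

Import Order.TTheory GRing.Theory Num.Theory.

Local Open Scope classical_set_scope.
Local Open Scope ring_scope.

Variant scalar_kind := RealScalars | ComplexScalars.

Definition scalars (RR : realType) (F : scalar_kind) : fieldType :=
  match F with RealScalars => RR | ComplexScalars => RR[i] end.

Section LinearAlgebra.
Context {K : fieldType}.

(* [U] is the internal direct sum of the linear subspaces listed in [Ws]. *)
Definition direct_sum (V : lmodType K) (Ws : seq (set V)) (U : set V) : Prop :=
  let families := [set w : nat -> V |
    forall i, (i < size Ws)%N -> nth set0 Ws i (w i)] in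
  [/\ forall i, (i < size Ws)%N -> submod_closed [in nth set0 Ws i],
      U = [set \sum_(i < size Ws) w i | w in families]
    & forall w, families w -> \sum_(i < size Ws) w i = 0 ->
        forall i, (i < size Ws)%N -> w i = 0].

(* The operator V^n -> W^m, v |-> (\sum_j A_ij v_j)_i, of an operator matrix. *)
Definition block_op (V W : lmodType K) (m n : nat)
    (A : 'I_m -> 'I_n -> {linear V -> W}) (v : {ffun 'I_n -> V}) :
    {ffun 'I_m -> W} :=
  [ffun i => \sum_(j < n) A i j (v j)].

Fact block_op_is_linear (V W : lmodType K) (m n : nat)
  (A : 'I_m -> 'I_n -> {linear V -> W}) : linear (block_op A).
Proof.
move=> a u v; apply/ffunP=> i; rewrite !ffunE scaler_sumr -big_split /=.
by apply: eq_bigr => j _; rewrite !ffunE linearP.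
Qed.

HB.instance Definition _ (V W : lmodType K) (m n : nat)
    (A : 'I_m -> 'I_n -> {linear V -> W}) :=
  GRing.isLinear.Build K {ffun 'I_n -> V} {ffun 'I_m -> W} _ (block_op A)
    (block_op_is_linear A).

Context {B Bbar : lmodType K}.
Implicit Types (L : nat -> {linear B -> Bbar}).

(* A vector (b_{k-1}, ..., b_0)^T of B^k is a function on 'I_k whose value at
   the index i is b_{k-1-i}; so b_0 sits at the last index, k-1. *)
Definition toeplitz L (k : nat) :
    {linear {ffun 'I_k -> B} -> {ffun 'I_k -> Bbar}} :=
  block_op (fun i j : 'I_k =>
    if (i <= j)%N then L (j - i)%N else (\0 : {linear B -> Bbar})).

(* N \cup {oo} is embedded in the extended reals. *)
Definition rank (RR : realType) L (b0 : B) : \bar RR :=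
  if L 0%N b0 == 0 then
    ereal_sup [set (k%:R)%:E | k in [set k : nat | (1 <= k)%N /\
      exists b : {ffun 'I_k -> B},
        (forall i : 'I_k, i = k.-1 :> nat -> b i = b0) /\ toeplitz L k b = 0]]
  else 0%E.

Definition stabilizes_at (RR : realType) L (k : nat) : Prop :=
  (forall b0 : B, (exists2 m : nat, (m <= k)%N & rank RR L b0 = m%:R%:E) \/
                  rank RR L b0 = +oo%E) /\
  (exists b0 : B, rank RR L b0 = k%:R%:E).

End LinearAlgebra.

Section Recursion.
Context {K : fieldType} (B Bbar : lmodType K).

(* The objects produced at a stage j. [E_ s i] and [M_ s i] stand for E_{i,j}
   and M_{i,j} and are meaningful for 1 <= i <= j only; [Sinv s] is meaningful
   on [R_ s] only. *)
Record stage := Stage {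
  Sbar : {linear B -> Bbar};
  S_ : {linear B -> Bbar};
  E_ : nat -> {linear B -> B};
  M_ : nat -> {linear B -> B};
  N_ : set B;
  R_ : set Bbar;
  Nc_ : set B;
  Rc_ : set Bbar;
  P_ : {linear Bbar -> Bbar};
  Sinv : Bbar -> B }.

Implicit Types (L : nat -> {linear B -> Bbar}) (D : nat -> stage) (j k : nat).

Definition initialized D : Prop :=
  [/\ N_ (D 0%N) = setT, Nc_ (D 0%N) = [set 0],
      R_ (D 0%N) = [set 0] & Rc_ (D 0%N) = setT].

Record stage_operators L D j : Prop := StageOperators {
  Sbar_first : j = 1%N -> forall b, Sbar (D j) b = L 0%N b;
  Sbar_next : (2 <= j)%N -> forall b,
    Sbar (D j) b = \sum_(1 <= i < j) L i (M_ (D j.-1) i b);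
  S_first : j = 1%N -> forall b, S_ (D j) b = L 0%N b;
  S_next : (2 <= j)%N -> forall b,
    S_ (D j) b = Sbar (D j) b - \sum_(1 <= i < j) P_ (D i) (Sbar (D j) b);
  E_diag : forall b, E_ (D j) j b = b;
  E_above : forall i, (1 <= i < j)%N -> forall b,
    E_ (D j) i b = - Sinv (D i) (P_ (D i)
      (\sum_(i.+1 <= nu < j.+1) Sbar (D nu) (E_ (D j) nu b)));
  M_first : forall b, M_ (D j) 1%N b = E_ (D j) 1%N b;
  M_next : forall i, (2 <= i <= j)%N -> forall b,
    M_ (D j) i b =
      \sum_(i <= nu < j.+1) M_ (D nu.-1) i.-1 (E_ (D j) nu b);
  N_def : N_ (D j) = [set n | N_ (D j.-1) n /\ S_ (D j) n = 0];
  R_def : R_ (D j) = S_ (D j) @` N_ (D j.-1) }.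

Definition complements D j (Nc : set B) (Rc : set Bbar) : Prop :=
  direct_sum [:: Nc; N_ (D j)] (N_ (D j.-1)) /\
  direct_sum [:: R_ (D j); Rc] (Rc_ (D j.-1)).

(* [p] is the projection onto R_j along
   Bbar = R_1 (+) ... (+) R_j (+) R_j^c. *)
Definition is_projection D j (p : Bbar -> Bbar) : Prop :=
  forall (r : nat -> Bbar) (c : Bbar),
    (forall i, (1 <= i <= j)%N -> R_ (D i) (r i)) -> Rc_ (D j) c ->
    p (\sum_(1 <= i < j.+1) r i + c) = r j.

(* [s] restricts to the inverse R_j -> N_j^c of S_j : N_j^c -> R_j. *)
Definition is_inverse D j (s : Bbar -> B) : Prop :=
  forall y, R_ (D j) y -> Nc_ (D j) (s y) /\ S_ (D j) (s y) = y.

(* The stages 0, ..., k of [D] have been produced by the recursion, with the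
   complements [Nc_ (D j)] and [Rc_ (D j)] chosen at the stages 1 <= j <= k;
   [D] is unconstrained beyond k. *)
Definition recursion L D k : Prop :=
  initialized D /\
  forall j, (1 <= j <= k)%N ->
    [/\ stage_operators L D j, complements D j (Nc_ (D j)) (Rc_ (D j)),
        is_projection D j (P_ (D j)) & is_inverse D j (Sinv (D j))].

(* M^{(k)}; the zero-based index i stands for i+1. *)
Definition M_mx D k : {linear {ffun 'I_k -> B} -> {ffun 'I_k -> B}} :=
  block_op (fun i j : 'I_k =>
    if (i <= j)%N then M_ (D j.+1) i.+1 else (\0 : {linear B -> B})).

(* The column (M_{1,j}, ..., M_{j-1,j}, I_B, 0, ..., 0)^T of height k. *)
Definition M_col D k j (n : B) : {ffun 'I_k -> B} :=
  [ffun i : 'I_k => if (i.+1 < j)%N then M_ (D j) i.+1 n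
                    else if i.+1 == j then n else 0].

End Recursion.

(* Main.v *)
(* The operators E_{i,j} are chosen such that in the first row of
   Delta^{(k)} M^{(k)} all components in R_1, ..., R_{j-1} cancel, which leaves
   the row (S_1, ..., S_k). Since M^{(k+1)} = diag(I_B, M^{(k)}) E^{(k+1)}, each
   further row is the preceding one, shifted and multiplied by E; as E_{i,j}
   (i < j) takes values in N_i^c, a subspace of N_{i-1}, on which S_{i-1}
   vanishes, the (i,j) entries with i >= 2 vanish on N_{j-1}. Hence M maps
   N_1 x ... x N_k into the kernel. Conversely, dropping b_k from a kernel
   element gives by induction an element of the range of M^{(k)}; solving the
   unipotent system E m = (b_k, n_1, ..., n_k) gives m_j in N_{j-1}, and the
   first row, sum_j S_j m_j = 0, forces S_j m_j = 0 by independence of the R_j.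
   The last component of M m being m_k, b_0 starts a chain of length k iff
   b_0 lies in N_k, and the statements on rank and stabilization are statements
   on the decreasing sequence N_k. *)

From HB Require Import structures.
Require Import Defs.
From mathcomp Require Import all_boot all_order all_algebra.
From mathcomp Require Import all_classical all_reals ereal.
From mathcomp Require Import zify.

Set Implicit Arguments.
Unset Strict Implicit.
Unset Printing Implicit Defensive.

Import Order.TTheory GRing.Theory Num.Theory.

Local Open Scope classical_set_scope.
Local Open Scope ring_scope.

(** * Subspaces and direct sums *)

Section Subspaces.
Context {K : fieldType}.
Implicit Types V W : lmodType K.

Definition subspace V (A : set V) : Prop :=
  A 0 /\ forall a u v, A u -> A v -> A (a *: u + v).

Lemma submod_closed_subspace V (A : set V) :
  submod_closed [in A] <-> subspace A.
Proof.
split=> -[A0 Alin]; split.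
- by move: A0; rewrite !inE.
- by move=> a u v Au Av; have := Alin a u v; rewrite !inE; apply.
- by rewrite !inE.
- by move=> a u v; rewrite !inE; apply: Alin.
Qed.

Section Closure.
Context {V : lmodType K} {A : set V}.
Context (sA : subspace A).

Lemma subspaceD u v : A u -> A v -> A (u + v).
Proof. by move=> Au Av; rewrite -(scale1r u); apply: sA.2. Qed.

Lemma subspaceZ a u : A u -> A (a *: u).
Proof. by move=> Au; rewrite -[_ *: _]addr0; apply: sA.2 => //; apply: sA.1. Qed.

Lemma subspaceN u : A u -> A (- u).
Proof. by move=> Au; rewrite -scaleN1r; apply: subspaceZ. Qed.

Lemma subspaceB u v : A u -> A v -> A (u - v).
Proof. by move=> Au Av; apply/subspaceD/subspaceN. Qed.

Lemma subspace_sum_nat m n (F : nat -> V) :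
  (forall i, (m <= i < n)%N -> A (F i)) -> A (\sum_(m <= i < n) F i).
Proof.
move=> AF; rewrite big_nat_cond; apply: big_ind => [||i /andP[/AF]//].
  exact: sA.1.
exact: subspaceD.
Qed.

End Closure.

Lemma subspace_image V W (f : {linear V -> W}) (A : set V) :
  subspace A -> subspace (f @` A).
Proof.
move=> [A0 Alin]; split; first by exists 0 => //; rewrite linear0.
move=> a _ _ [u Au <-] [v Av <-]; exists (a *: u + v); first exact: Alin.
by rewrite linearP.
Qed.

Lemma linear_eqfun V W (f : V -> W) :
  linear f -> exists g : {linear V -> W}, g =1 f.
Proof.
move=> flin; pose flinM := GRing.isLinear.Build K V W _ f flin.
by exists (HB.pack f flinM : {linear V -> W}).
Qed.

Lemma direct_sum_iotaP V (F : nat -> set V) k (U : set V) :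
  direct_sum [seq F i | i <- iota 1 k] U <->
  [/\ forall i, (1 <= i <= k)%N -> subspace (F i),
      forall v, U v <-> exists2 r, (forall i, (1 <= i <= k)%N -> F i (r i)) &
        v = \sum_(1 <= i < k.+1) r i
    & forall r, (forall i, (1 <= i <= k)%N -> F i (r i)) ->
        \sum_(1 <= i < k.+1) r i = 0 ->
        forall i, (1 <= i <= k)%N -> r i = 0].
Proof.
have nthE i : (i < k)%N -> nth set0 [seq F i | i <- iota 1 k] i = F i.+1.
  by move=> ik; rewrite (nth_map 0%N) ?size_iota// nth_iota.
have sumE (r : nat -> V) :
    \sum_(1 <= i < k.+1) r i = \sum_(i < k) r i.+1.
  by rewrite big_add1 big_mkord.
rewrite /direct_sum /= size_map size_iota.
split=> -[Fs UE Find]; split.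
- move=> i /andP[i0 ik]; rewrite -(prednK i0) -nthE; last by lia.
  by apply/submod_closed_subspace/Fs; lia.
- move=> v; rewrite UE; split=> [[w Fw <-]|[r Fr ->]].
    exists (w \o predn); last by rewrite sumE.
    move=> i /andP[i0 ik] /=; rewrite -{1}(prednK i0) -nthE; last by lia.
    by apply: Fw; lia.
  exists (r \o S) => [i ik /=|]; last by rewrite sumE.
  by rewrite nthE//; apply: Fr; lia.
- move=> r Fr; rewrite sumE => /(Find (r \o S)) /= r0 i /andP[i0 ik].
  rewrite -(prednK i0); apply: r0; last by lia.
  by move=> {i0 ik}i ik; rewrite nthE//; apply: Fr; lia.
- by move=> i ik; rewrite nthE//; apply/submod_closed_subspace/Fs; lia.
- apply/seteqP; split=> [v /UE[r Fr ->]|_ [w Fw <-]].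
    exists (r \o S) => [i ik /=|]; last by rewrite sumE.
    by rewrite nthE//; apply: Fr; lia.
  apply/UE; exists (w \o predn); last by rewrite sumE.
  move=> i /andP[i0 ik] /=; rewrite -{1}(prednK i0) -nthE; last by lia.
  by apply: Fw; lia.
- move=> w Fw /= sw0 i ik.
  apply: (Find (w \o predn) _ _ i.+1 ik); last by rewrite sumE.
  move=> {ik}i /andP[i0 ik] /=; rewrite -{1}(prednK i0) -nthE; last by lia.
  by apply: Fw; lia.
Qed.

Lemma direct_sum2P V (X W U : set V) :
  direct_sum [:: X; W] U <->
  [/\ subspace X, subspace W,
      forall u, U u <-> exists x w, [/\ X x, W w & u = x + w]
    & forall x, X x -> W x -> x = 0].
Proof.
pose F i := if i == 1%N then X else W.
rewrite -[[:: X; W]]/[seq F i | i <- iota 1 2] direct_sum_iotaP.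
have sum2 (r : nat -> V) : \sum_(1 <= i < 3) r i = r 1%N + r 2%N.
  by rewrite big_ltn// big_nat1.
have F2 (r : nat -> V) : (forall i, (1 <= i <= 2)%N -> F i (r i)) <->
    X (r 1%N) /\ W (r 2%N).
  split=> [Fr|[X1 W2] [|[|[|]]]//]; by split; [apply: (Fr 1%N)|apply: (Fr 2%N)].
split=> [[Fs UE Find]|[sX sW UE XW0]]; split.
- exact: (Fs 1%N).
- exact: (Fs 2%N).
- move=> u; rewrite UE; split=> [[r /F2[Xr Wr] ->]|[x [w [Xx Ww ->]]]].
    by exists (r 1%N), (r 2%N); rewrite sum2.
  exists (fun i => if i == 1%N then x else w); first exact/F2.
  by rewrite sum2.
- move=> x Xx Wx.
  apply: (Find (fun i => if i == 1%N then x else - x) _ _ 1%N) => //.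
    by apply/F2; split=> //=; apply: subspaceN => //; apply: (Fs 2%N).
  by rewrite sum2 /= subrr.
- by case=> [|[|[|]]].
- move=> u; rewrite UE; split=> [[x [w [Xx Ww ->]]]|[r /F2[Xr Wr] ->]].
    exists (fun i => if i == 1%N then x else w); first exact/F2.
    by rewrite sum2.
  by exists (r 1%N), (r 2%N); rewrite sum2.
- move=> r /F2[Xr Wr]; rewrite sum2 => /eqP; rewrite addr_eq0 => /eqP r12.
  have r20 : r 2%N = 0.
    by apply: XW0 => //; rewrite -[r 2%N]opprK -r12; apply: subspaceN.
  by case=> [|[|[|]]]// _; rewrite r12 r20 oppr0.
Qed.

Definition decomposes V (F : nat -> set V) k (U : set V) : Prop :=
  [/\ forall i, (1 <= i <= k)%N -> subspace (F i), subspace U,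
      forall v, exists r c,
        [/\ forall i, (1 <= i <= k)%N -> F i (r i), U c &
            v = \sum_(1 <= i < k.+1) r i + c]
    & forall r c, (forall i, (1 <= i <= k)%N -> F i (r i)) -> U c ->
        \sum_(1 <= i < k.+1) r i + c = 0 ->
        (forall i, (1 <= i <= k)%N -> r i = 0) /\ c = 0].

Lemma decomposes_direct_sum V (F : nat -> set V) k (U : set V) :
  decomposes F k U -> direct_sum (rcons [seq F i | i <- iota 1 k] U) setT.
Proof.
move=> [Fs Us FUT FU0].
pose F' i := if (i <= k)%N then F i else U.
have F'E i : (i <= k)%N -> F' i = F i by rewrite /F' => ->.
have F'k : F' k.+1 = U by rewrite /F' ltnn.
have -> : rcons [seq F i | i <- iota 1 k] U = [seq F' i | i <- iota 1 k.+1].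
  rewrite -[k.+1]addn1 iotaD map_cat /= add1n F'k cats1; congr rcons.
  by apply/eq_in_map => i; rewrite mem_iota => ik; rewrite F'E//; lia.
apply/direct_sum_iotaP; split.
- move=> i /andP[i0]; rewrite leq_eqVlt => /orP[/eqP->|ik]; first by rewrite F'k.
  by rewrite F'E//; apply: Fs; lia.
- move=> v; split=> // _; have [r [c [Fr Uc ->]]] := FUT v.
  exists (fun i => if (i <= k)%N then r i else c) => [i ik|].
    rewrite /F'; case: ifP => // ik'; first by apply: Fr; lia.
  rewrite [RHS]big_nat_recr//= ltnn; congr (_ + _).
  by apply: eq_big_nat => i ik; rewrite ifT//; lia.
- move=> r Fr; rewrite big_nat_recr//= => /FU0[||r0 c0].
  + by move=> i ik; rewrite -F'E; [apply: Fr|]; lia.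
  + by rewrite -F'k; apply: Fr; lia.
  + move=> i /andP[i0]; rewrite leq_eqVlt => /orP[/eqP->//|ik].
    by apply: r0; lia.
Qed.

Lemma decomposesS V (F : nat -> set V) k (U U' : set V) :
  decomposes F k U -> direct_sum [:: F k.+1; U'] U -> decomposes F k.+1 U'.
Proof.
move=> [Fs Us FUT FU0] /direct_sum2P[sF sU' UE FU'0]; split=> //.
- move=> i /andP[i0]; rewrite leq_eqVlt => /orP[/eqP->//|ik].
  by apply: Fs; lia.
- move=> v; have [r [c [Fr /UE[x [w [Fx Uw ->]]] ->]]] := FUT v.
  exists (fun i => if (i <= k)%N then r i else x), w; split=> //.
    move=> i /andP[i0]; rewrite leq_eqVlt => /orP[/eqP->|ik].
      by rewrite ltnn.
    by rewrite ifT//; apply: Fr; lia.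
  rewrite [in RHS]big_nat_recr//= ltnn addrA; congr (_ + _ + _).
  by apply: eq_big_nat => i ik; rewrite ifT//; lia.
- move=> r c Fr U'c; rewrite big_nat_recr//= -addrA.
  have Fk : F k.+1 (r k.+1) by apply: Fr; lia.
  move=> /FU0[||r0 /eqP].
  + by move=> i ik; apply: Fr; lia.
  + by apply/UE; exists (r k.+1), c.
  rewrite addr_eq0 => /eqP rc.
  have c0 : c = 0.
    by apply: FU'0 => //; rewrite -[c]opprK -rc; apply: subspaceN.
  split=> // i /andP[i0]; rewrite leq_eqVlt => /orP[/eqP->|ik].
    by rewrite rc c0 oppr0.
  by apply: r0; lia.
Qed.

Lemma decomposes_uniq V (F : nat -> set V) k (U : set V) r c r' c' :
  decomposes F k U ->
  (forall i, (1 <= i <= k)%N -> F i (r i)) -> U c ->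
  (forall i, (1 <= i <= k)%N -> F i (r' i)) -> U c' ->
  \sum_(1 <= i < k.+1) r i + c = \sum_(1 <= i < k.+1) r' i + c' ->
  (forall i, (1 <= i <= k)%N -> r i = r' i) /\ c = c'.
Proof.
move=> [Fs Us _ FU0] Fr Uc Fr' Uc' /eqP; rewrite -subr_eq0 opprD addrACA.
rewrite -sumrB => /eqP /FU0[||r0 /eqP].
- by move=> i ik; apply: (subspaceB (Fs i ik)); [exact: Fr|exact: Fr'].
- exact: subspaceB.
by rewrite subr_eq0 => /eqP; split=> // i /r0/eqP; rewrite subr_eq0 => /eqP.
Qed.

Lemma decomposes_proj V (F : nat -> set V) k (U : set V) j :
  decomposes F k U -> (1 <= j <= k)%N ->
  exists p : {linear V -> V},
    forall r c, (forall i, (1 <= i <= k)%N -> F i (r i)) -> U c ->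
      p (\sum_(1 <= i < k.+1) r i + c) = r j.
Proof.
move=> dF jk; have [Fs Us FUT _] := dF.
have /choice[rc rcP] : forall v, exists rc : (nat -> V) * V,
    [/\ forall i, (1 <= i <= k)%N -> F i (rc.1 i), U rc.2 &
        v = \sum_(1 <= i < k.+1) rc.1 i + rc.2].
  by move=> v; have [r [c ?]] := FUT v; exists (r, c).
have plin : linear (fun v => (rc v).1 j).
  move=> a u v; have [Fu Uu uE] := rcP u; have [Fv Uv vE] := rcP v.
  have [Fw Uw wE] := rcP (a *: u + v).
  have [] := decomposes_uniq (r := (rc (a *: u + v)).1)
    (r' := fun i => a *: (rc u).1 i + (rc v).1 i)
    (c' := a *: (rc u).2 + (rc v).2) dF Fw Uw.
  - by move=> i ik; apply: (Fs i ik).2; [exact: Fu|exact: Fv].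
  - exact: Us.2.
  - rewrite -wE {1}uE {1}vE scalerDr addrACA big_split /= scaler_sumr.
    by [].
  - by move=> /(_ j jk).
have [p pE] := linear_eqfun plin.
exists p => r c Fr Uc; rewrite pE; have [Fw Uw wE] := rcP (\sum_(1 <= i < k.+1) r i + c).
by have [/(_ j jk)] := decomposes_uniq dF Fr Uc Fw Uw wE.
Qed.

Lemma direct_complement V (W U : set V) :
  subspace U -> subspace W -> W `<=` U -> exists X, direct_sum [:: X; W] U.
Proof.
move=> sU sW WU.
pose P (X : set V) := [/\ forall a u v, X u -> X v -> X (a *: u + v),
  X `<=` U & forall x, X x -> W x -> x = 0].
have [|X [[Xlin XU XW0] Xmax]] := @Zorn_bigcup V P.
  move=> F FP Ftot; split.
  - move=> a u v [A FA Au] [A' FA' A'v].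
    have [AA'|A'A] := Ftot A A' FA FA'.
      by exists A' => //; have [lA' _ _] := FP _ FA'; apply: lA' => //; apply: AA'.
    by exists A => //; have [lA _ _] := FP _ FA; apply: lA => //; apply: A'A.
  - by move=> u [A FA Au]; have [_ AU _] := FP _ FA; apply: AU.
  - by move=> u [A FA Au]; have [_ _ A0] := FP _ FA; apply: A0.
have X0 : X 0.
  apply: contrapT => nX0; apply: (Xmax [set 0]).
    split; last by move=> /(_ 0 erefl).
    move=> x Xx; exfalso; apply: nX0.
    by rewrite -(subrr x) -[- x]scaleN1r addrC; apply: Xlin.
  split=> [a u v -> ->|x ->|x ->//]; first by rewrite scaler0 addr0.
  exact: sU.1.
have sX : subspace X by [].
exists X; apply/direct_sum2P; split=> // u; split; last first.
  by move=> [x [w [Xx Ww ->]]]; apply: (subspaceD sU); [exact: XU|exact: WU].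
move=> Uu; apply: contrapT => nXWu.
pose Y := [set y | exists a x, X x /\ y = a *: u + x].
apply: (Xmax Y); first split.
- by move=> x Xx; exists 0, x; rewrite scale0r add0r.
- move=> /(_ u) YX; apply: nXWu; exists u, 0; rewrite addr0; split=> //.
    by apply: YX; exists 1, 0; rewrite scale1r addr0.
  exact: sW.1.
split.
- move=> c _ _ [a [x [Xx ->]]] [b [y [Xy ->]]].
  exists (c * a + b), (c *: x + y); split; first exact: Xlin.
  by rewrite scalerDr scalerA addrACA -scalerDl.
- move=> _ [a [x [Xx ->]]]; apply: sU.2 => //; exact: XU.
- move=> _ [a [x [Xx ->]]] Wy.
  have [a0|a0] := eqVneq a 0.
    by move: Wy; rewrite a0 scale0r add0r; apply: XW0.
  exfalso; apply: nXWu; exists (a^-1 *: - x), (a^-1 *: (a *: u + x)).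
  split; [|exact: subspaceZ|].
    by apply: (subspaceZ sX); apply: subspaceN.
  by rewrite -scalerDr addrCA addNr addr0 scalerA mulVf// scale1r.
Qed.

End Subspaces.

(** * The recursion *)

Section Stages.
Context {K : fieldType} {B Bbar : lmodType K} (L : nat -> {linear B -> Bbar}).
Implicit Types (D : nat -> stage B Bbar) (i j k : nat).

Lemma recursion_le D j k : (j <= k)%N -> recursion L D k -> recursion L D j.
Proof. by move=> jk [D0 Dk]; split=> // i ij; apply: Dk; lia. Qed.

Lemma recursion_stage D k : (0 < k)%N -> recursion L D k ->
  [/\ stage_operators L D k, complements D k (Nc_ (D k)) (Rc_ (D k)),
      is_projection D k (P_ (D k)) & is_inverse D k (Sinv (D k))].
Proof. by move=> k0 [_]; apply; rewrite k0 leqnn. Qed.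

Lemma subspace_N D k : recursion L D k -> subspace (N_ (D k)).
Proof.
elim: k => [|k IH] Dk; first by have [[-> _ _ _] _] := Dk.
have [sN0 sN] := IH (recursion_le (leqnSn k) Dk).
have [/N_def-> _ _ _] := recursion_stage (ltn0Sn _) Dk.
split=> [|a u v [Nu Su] [Nv Sv]]; first by rewrite /= linear0.
by split; [exact: sN|rewrite linearP Su Sv scaler0 addr0].
Qed.

Lemma recursion_decomposesN D k :
  recursion L D k -> decomposes (fun i => Nc_ (D i)) k (N_ (D k)).
Proof.
elim: k => [|k IH] Dk.
  have [[-> _ _ _] _] := Dk; split=> // [|v|r c _ _].
  - by move=> i; lia.
  - by exists (fun=> 0), v; split=> //; [move=> i; lia|rewrite big_geq// add0r].
  - by rewrite big_geq// add0r => ->; split=> // i; lia.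
apply: decomposesS (IH (recursion_le (leqnSn k) Dk)) _.
by have [_ []] := recursion_stage (ltn0Sn _) Dk.
Qed.

Lemma recursion_decomposesR D k :
  recursion L D k -> decomposes (fun i => R_ (D i)) k (Rc_ (D k)).
Proof.
elim: k => [|k IH] Dk.
  have [[_ _ _ ->] _] := Dk; split=> // [|v|r c _ _].
  - by move=> i; lia.
  - by exists (fun=> 0), v; split=> //; [move=> i; lia|rewrite big_geq// add0r].
  - by rewrite big_geq// add0r => ->; split=> // i; lia.
apply: decomposesS (IH (recursion_le (leqnSn k) Dk)) _.
by have [_ []] := recursion_stage (ltn0Sn _) Dk.
Qed.

Lemma Rc_decr D i k : recursion L D k -> (i <= k)%N -> Rc_ (D k) `<=` Rc_ (D i).
Proof.
elim: k => [|k IH] Dk ik; first by have -> : i = 0%N by lia.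
have [->//|nik] := eqVneq i k.+1.
apply: subset_trans (IH (recursion_le (leqnSn k) Dk) _); last by lia.
have [_ [_ /direct_sum2P[sR _ RcE _]] _ _] := recursion_stage (ltn0Sn _) Dk.
by move=> c Rcc; apply/RcE; exists 0, c; rewrite add0r; split=> //; apply: sR.1.
Qed.

Lemma R_subset_Rc D i k :
  recursion L D k -> (i < k)%N -> R_ (D k) `<=` Rc_ (D i).
Proof.
case: k => // k Dk ik; apply: subset_trans (Rc_decr (recursion_le (leqnSn k) Dk) ik).
have [_ [_ /direct_sum2P[_ sRc RcE _]] _ _] := recursion_stage (ltn0Sn _) Dk.
by move=> x Rx; apply/RcE; exists x, 0; rewrite addr0; split=> //; apply: sRc.1.
Qed.

(* The projections of the different stages, taken along different
   decompositions, agree with the components of the finest one. *)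
Lemma recursion_projE D k r c i : recursion L D k ->
  (forall l, (1 <= l <= k)%N -> R_ (D l) (r l)) -> Rc_ (D k) c ->
  (1 <= i <= k)%N -> P_ (D i) (\sum_(1 <= l < k.+1) r l + c) = r i.
Proof.
move=> Dk Rr Rcc /andP[i0 ik].
have Di := recursion_le ik Dk.
have [_ sRc _ _] := recursion_decomposesR Di.
rewrite (big_cat_nat _ (n := i.+1))//= -addrA.
have [_ _ Pi _] := recursion_stage i0 Di.
apply: Pi => [l il|]; first by apply: Rr; lia.
apply: (subspaceD sRc); last exact: Rc_decr Dk ik _ Rcc.
apply: (subspace_sum_nat sRc) => l il.
by apply: (R_subset_Rc (recursion_le _ Dk) (k := l)); [lia|lia|apply: Rr; lia].
Qed.

Lemma P_range D k y : recursion L D k -> (1 <= k)%N -> R_ (D k) (P_ (D k) y).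
Proof.
move=> Dk k0; have [_ _ /(_ y)[r [c [Rr Rcc ->]]] _] := recursion_decomposesR Dk.
by rewrite (recursion_projE Dk)//; [apply: Rr|]; lia.
Qed.

Lemma S_range D k b :
  recursion L D k -> stage_operators L D k.+1 -> Rc_ (D k) (S_ (D k.+1) b).
Proof.
move=> Dk opk; case: k => [|k] in Dk opk *; first by have [[_ _ _ ->] _] := Dk.
rewrite (S_next opk)//.
have [_ _ /(_ (Sbar (D k.+2) b))[r [c [Rr Rcc ->]]] _] := recursion_decomposesR Dk.
rewrite [X in _ - X](eq_big_nat _ _ (F2 := r)).
  by rewrite addrAC subrr add0r.
by move=> i ik; apply: (recursion_projE Dk) => //; lia.
Qed.

Lemma M_diag D k b :
  recursion L D k -> stage_operators L D k.+1 -> M_ (D k.+1) k.+1 b = b.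
Proof.
elim: k b => [|k IH] b Dk opk; first by rewrite (M_first opk) (E_diag opk).
rewrite (M_next opk) ?leqnn// big_nat1 (E_diag opk) /=.
by apply: IH (recursion_le (leqnSn k) Dk) _; have [] := recursion_stage (ltn0Sn _) Dk.
Qed.

Lemma complements_exist D k : recursion L D k -> stage_operators L D k.+1 ->
  exists Nc Rc, complements D k.+1 Nc Rc.
Proof.
move=> Dk opk; have sN := subspace_N Dk.
have [_ sRc _ _] := recursion_decomposesR Dk.
have [||Nc NcP] := @direct_complement _ _ (N_ (D k.+1)) (N_ (D k)) sN.
- rewrite (N_def opk); split=> [|a u v [Nu Su] [Nv Sv]] /=.
    by rewrite linear0; split=> //; apply: sN.1.
  by rewrite linearP Su Sv scaler0 addr0; split=> //; apply: sN.2.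
- by rewrite (N_def opk) => n [].
have [||Rc RcP] := @direct_complement _ _ (R_ (D k.+1)) (Rc_ (D k)) sRc.
- by rewrite (R_def opk); apply: subspace_image.
- by rewrite (R_def opk) => _ [n _ <-]; apply: S_range.
exists Nc, Rc; split=> //.
move: RcP => /direct_sum2P[sRc' sR RcE Rc0]; apply/direct_sum2P; split=> //.
- move=> u; rewrite RcE; split=> -[x [w [? ? ->]]].
    by exists w, x; rewrite addrC.
  by exists w, x; rewrite addrC.
- by move=> x ? ?; apply: Rc0.
Qed.

Lemma S_bij D j : stage_operators L D j -> complements D j (Nc_ (D j)) (Rc_ (D j)) ->
  set_bij (Nc_ (D j)) (R_ (D j)) (S_ (D j)).
Proof.
move=> opj [/direct_sum2P[sNc sN NE Nc0] _].
have NcN n : Nc_ (D j) n -> N_ (D j.-1) n.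
  by move=> Ncn; apply/NE; exists n, 0; rewrite addr0; split=> //; apply: sN.1.
rewrite (R_def opj); split.
- by move=> n /NcN Nn; exists n.
- move=> m n; rewrite !inE => Ncm Ncn Smn; apply/eqP; rewrite -subr_eq0.
  have Ncmn : Nc_ (D j) (m - n) by apply: subspaceB.
  apply/eqP/Nc0 => //; rewrite (N_def opj); split; first exact: NcN.
  by rewrite linearB Smn subrr.
- move=> _ [n /NE[m [n' [Ncm Nn' ->]]] <-]; exists m => //.
  by move: Nn'; rewrite linearD (N_def opj) => -[_ ->]; rewrite addr0.
Qed.

Lemma SinvP_linear D i : recursion L D i -> (1 <= i)%N ->
  exists g : {linear Bbar -> B}, forall y, g y = Sinv (D i) (P_ (D i) y).
Proof.
move=> Di i0; apply: linear_eqfun => a u v.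
have [opi Ci _ inv] := recursion_stage i0 Di.
have [_ Sinj _] := S_bij opi Ci.
have [Nc0 Nclin] : subspace (Nc_ (D i)).
  by have [sNc _ _ _] := recursion_decomposesN Di; apply: sNc; rewrite i0 leqnn.
have PR y := P_range y Di i0.
have [Ncu Su] := inv _ (PR u); have [Ncv Sv] := inv _ (PR v).
have [Ncw Sw] := inv _ (PR (a *: u + v)).
apply: (Sinj _ _ (mem_set Ncw) (mem_set (Nclin _ _ _ Ncu Ncv))).
by rewrite Sw !linearP Su Sv.
Qed.

Lemma linear_sum_nat (V W : lmodType K) m n (F : nat -> {linear V -> W}) :
  exists g : {linear V -> W}, forall v, g v = \sum_(m <= i < n) F i v.
Proof.
apply: linear_eqfun => a u v; rewrite scaler_sumr -big_split /=.
by apply: eq_bigr => i _; rewrite linearP.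
Qed.

Lemma back_recursion (T : Type) (Q : nat -> (nat -> T) -> T -> Prop) k :
  (forall i f f' x, (forall nu, (i < nu)%N -> f nu = f' nu) ->
     Q i f x -> Q i f' x) ->
  (forall i f, exists x, Q i f x) ->
  T -> exists f, forall i, (i <= k)%N -> Q i f (f i).
Proof.
move=> Qloc Qtot x0.
suff /(_ k.+1) [f fP] : forall m, exists f, forall i,
    (k < i + m)%N -> (i <= k)%N -> Q i f (f i).
  by exists f => i ik; apply: fP => //; lia.
elim=> [|m [f fP]]; first by exists (fun=> x0) => i; lia.
have [km|mk] := ltnP k m.
  by exists f => i _ ik; apply: fP => //; lia.
have [x Qx] := Qtot (k - m)%N f.
exists (fun i => if i == (k - m)%N then x else f i) => i kim ik.
apply: (Qloc i f) => [nu inu|]; first by rewrite ifN//; lia.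
by case: eqVneq => [->//|ikm]; apply: fP => //; lia.
Qed.

Lemma E_exists (T : nat -> {linear B -> Bbar}) (g : nat -> {linear Bbar -> B}) j :
  exists E : nat -> {linear B -> B}, (forall b, E j b = b) /\
    forall i, (i < j)%N -> forall b,
      E i b = - g i (\sum_(i.+1 <= nu < j.+1) T nu (E nu b)).
Proof.
pose Q i (E : nat -> {linear B -> B}) (e : {linear B -> B}) := forall b,
  e b = if i == j then b else - g i (\sum_(i.+1 <= nu < j.+1) T nu (E nu b)).
have [||E EP] := @back_recursion _ Q j _ _ idfun.
- move=> i E E' e EE' eE b; rewrite eE; case: eqP => // _; congr (- g i _).
  by apply: eq_big_nat => nu /andP[inu _]; rewrite EE'.
- move=> i E; rewrite /Q; case: eqP => _; first by exists idfun.
  have [h hE] := linear_sum_nat i.+1 j.+1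
    (fun nu => T nu \o E nu : {linear B -> Bbar}).
  by exists (\- (g i \o h)) => b; rewrite /= hE.
exists E; split=> [b|i ij b]; rewrite EP// ?eqxx// ?ltn_eqF//.
exact: ltnW.
Qed.

Lemma stage_exists D k : recursion L D k -> exists D' : nat -> stage B Bbar,
  (forall j, (j <= k)%N -> D' j = D j) /\ stage_operators L D' k.+1.
Proof.
move=> Dk.
have [Sb SbP] : exists Sb : {linear B -> Bbar},
    (k = 0%N -> forall b, Sb b = L 0%N b) /\
    ((0 < k)%N -> forall b, Sb b = \sum_(1 <= i < k.+1) L i (M_ (D k) i b)).
  case: (posnP k) => [k0|k0]; first by exists (L 0%N).
  have [Sb SbE] := linear_sum_nat 1 k.+1
    (fun i => L i \o M_ (D k) i : {linear B -> Bbar}).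
  by exists Sb; split=> //; lia.
have [PS PSE] := linear_sum_nat 1 k.+1 (fun i => P_ (D i) \o Sb : {linear B -> Bbar}).
pose S1 : {linear B -> Bbar} := Sb \- PS.
have /choice[g gP] : forall i, exists g : {linear Bbar -> B},
    (1 <= i <= k)%N -> forall y, g y = Sinv (D i) (P_ (D i) y).
  move=> i; have [/andP[i0 ik]|_] := boolP (1 <= i <= k)%N.
    by have [g gE] := SinvP_linear (recursion_le ik Dk) i0; exists g.
  by exists \0.
pose T nu := if (nu <= k)%N then Sbar (D nu) else Sb.
have [E [Ek EP]] := E_exists T g k.+1.
have /choice[M MP] : forall i, exists M : {linear B -> B}, forall b,
    M b = if i == 1%N then E 1%N b
          else \sum_(i <= nu < k.+2) M_ (D nu.-1) i.-1 (E nu b).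
  move=> i; case: eqP => _; first by exists (E 1%N).
  exact: linear_sum_nat i k.+2 (fun nu => M_ (D nu.-1) i.-1 \o E nu : {linear B -> B}).
pose N1 := [set n | N_ (D k) n /\ S1 n = 0].
pose R1 := S1 @` N_ (D k).
pose s := Stage Sb S1 E M N1 R1 set0 set0 \0 (fun=> 0).
pose D' j := if (j <= k)%N then D j else s.
have D'E j : (j <= k)%N -> D' j = D j by rewrite /D' => ->.
have D'k : D' k.+1 = s by rewrite /D' ltnn.
exists D'; split=> //; split; rewrite ?D'k /= ?D'E//.
- by move=> [k0] b; apply: SbP.1.
- by move=> k0 b; rewrite SbP.2.
- move=> [k0] b; rewrite /S1 /= PSE k0 big_geq// subr0; exact: SbP.1.
- move=> k0 b; rewrite PSE; congr (_ - _); apply: eq_big_nat => i ik.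
  by rewrite D'E//; lia.
- move=> i ik b; rewrite EP; last by lia.
  rewrite D'E; last by lia.
  rewrite gP; last by lia.
  congr (- Sinv _ (P_ _ _)); apply: eq_big_nat => nu nuk.
  by rewrite /T /D'; case: ifP.
- move=> i ik b; rewrite MP ifN; last by lia.
  by apply: eq_big_nat => nu nuk; rewrite D'E//; lia.
Qed.

Lemma projection_exists D j : (1 <= j)%N ->
  decomposes (fun i => R_ (D i)) j (Rc_ (D j)) ->
  exists p : {linear Bbar -> Bbar}, is_projection D j p /\
    forall p' : Bbar -> Bbar, is_projection D j p' -> p' =1 p.
Proof.
move=> j0 dR; have [|p pP] := decomposes_proj (j := j) dR; first by lia.
exists p; split=> // p' p'P y.
have [_ _ /(_ y)[r [c [Rr Rcc ->]]] _] := dR.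
by rewrite pP// p'P.
Qed.

Lemma inverse_exists D j : set_bij (Nc_ (D j)) (R_ (D j)) (S_ (D j)) ->
  exists s : Bbar -> B, is_inverse D j s.
Proof.
move=> [_ _ Ssurj].
have /choice[s sP] : forall y, exists n, R_ (D j) y -> Nc_ (D j) n /\ S_ (D j) n = y.
  move=> y; have [Ry|nRy] := pselect (R_ (D j) y); last by exists 0.
  by have [n Ncn <-] := Ssurj y Ry; exists n.
by exists s => y /sP.
Qed.

End Stages.

(** * The kernel of the Toeplitz operator *)

Lemma exchange_big_nat_lt (V : nmodType) m n (F : nat -> nat -> V) :
  \sum_(m <= i < n) \sum_(m <= l < i) F i l =
  \sum_(m <= l < n) \sum_(l.+1 <= i < n) F i l.
Proof.
under eq_big_nat => i /andP[_ /ltnW iln] do rewrite (big_nat_widen _ _ n)//.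
rewrite (exchange_big_dep_nat xpredT)//=.
by apply: eq_big_nat => l /andP[ml _]; rewrite [RHS](@big_nat_widenl _ _ _ _ m) ?leqW.
Qed.

Lemma exchange_big_nat_le (V : nmodType) m n (F : nat -> nat -> V) :
  \sum_(m <= i < n) \sum_(i <= l < n) F i l =
  \sum_(m <= l < n) \sum_(m <= i < l.+1) F i l.
Proof.
under eq_big_nat => i /andP[mi _] do rewrite (@big_nat_widenl _ _ _ _ m)//.
rewrite (exchange_big_dep_nat xpredT)//=.
by apply: eq_big_nat => l /andP[_ ln]; rewrite [RHS](big_nat_widen _ _ n).
Qed.

Section Kernel.
Context {K : fieldType} {B Bbar : lmodType K} {L : nat -> {linear B -> Bbar}}.
Context {D : nat -> stage B Bbar}.
Context (Drec : forall k, recursion L D k).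

Let op j (j0 : (0 < j)%N) : stage_operators L D j.
Proof. by have [] := recursion_stage j0 (Drec j). Qed.

Lemma N_decr i j : (i <= j)%N -> N_ (D j) `<=` N_ (D i).
Proof.
elim: j => [|j IH] ij; first by have -> : i = 0%N by lia.
have [->//|nij] := eqVneq i j.+1.
apply: subset_trans (IH _); last by lia.
by rewrite (N_def (op (ltn0Sn j))) => n [].
Qed.

Lemma Nc_subset_N k : Nc_ (D k.+1) `<=` N_ (D k).
Proof.
have [_ [/direct_sum2P[_ sN NE _] _] _ _] := recursion_stage (ltn0Sn k) (Drec _).
by move=> n Ncn; apply/NE; exists n, 0; rewrite addr0; split=> //; apply: sN.1.
Qed.

Lemma Nc_N_eq0 k n : Nc_ (D k.+1) n -> N_ (D k.+1) n -> n = 0.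
Proof.
have [_ [/direct_sum2P[_ _ _ Nc0] _] _ _] := recursion_stage (ltn0Sn k) (Drec _).
exact: Nc0.
Qed.

Lemma M_diagE j b : (0 < j)%N -> M_ (D j) j b = b.
Proof. by case: j => // j _; apply: (M_diag _ (Drec j)); apply: op. Qed.

Lemma E_SinvP i j b : (1 <= i < j)%N ->
  Nc_ (D i) (E_ (D j) i b) /\
  S_ (D i) (E_ (D j) i b) =
    - P_ (D i) (\sum_(i.+1 <= nu < j.+1) Sbar (D nu) (E_ (D j) nu b)).
Proof.
move=> ij; rewrite (E_above (op _) ij); last by lia.
have i0 : (0 < i)%N by lia.
have [_ _ _ inv] := recursion_stage i0 (Drec i).
set y := \sum_(_ <= _ < _) _.
have [Ncy Sy] := inv _ (P_range y (Drec i) i0).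
split; last by rewrite linearN Sy.
have [sNc _ _ _] := recursion_decomposesN (Drec i).
by apply: subspaceN Ncy; apply: sNc; rewrite i0 leqnn.
Qed.

Lemma SbarE j b : (0 < j)%N ->
  Sbar (D j) b = S_ (D j) b + \sum_(1 <= i < j) P_ (D i) (Sbar (D j) b).
Proof.
case: j => // -[|j] _.
  by rewrite big_geq// addr0 (Sbar_first (op _))// (S_first (op _)).
by rewrite (S_next (op _))// subrK.
Qed.

(* The operators E are chosen such that all components in R_1, ..., R_{j-1}
   cancel in the sum. *)
Lemma sum_Sbar_E j b : (0 < j)%N ->
  \sum_(1 <= nu < j.+1) Sbar (D nu) (E_ (D j) nu b) = S_ (D j) b.
Proof.
move=> j0; set y := fun nu => Sbar (D nu) (E_ (D j) nu b).
under eq_big_nat => nu /andP[nu0 _] do rewrite SbarE//.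
rewrite big_split /= (exchange_big_nat_lt _ _ (fun i l => P_ (D l) (y i))).
rewrite [X in _ + X]big_nat_recr//= [X in _ + (_ + X)]big_geq// addr0.
rewrite big_nat_recr//= (E_diag (op j0)) addrAC -big_split /= big_nat_cond.
rewrite big1 ?add0r// => i; rewrite andbT => ij.
by rewrite (E_SinvP _ ij).2 -linear_sum addNr.
Qed.

(* The (i, j) entry of the product of the Toeplitz operator with M. *)
Definition toeplitzM i j (b : B) : Bbar :=
  \sum_(i <= l < j.+1) L (l - i)%N (M_ (D j) l b).

Lemma toeplitzM_first j b : (0 < j)%N -> toeplitzM 1 j b = S_ (D j) b.
Proof.
move=> j0; rewrite -sum_Sbar_E// /toeplitzM big_ltn// [RHS]big_ltn//.
rewrite (M_first (op j0)) subnn (Sbar_first (op _))//; congr (_ + _).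
transitivity (\sum_(2 <= l < j.+1) \sum_(l <= nu < j.+1)
    L l.-1 (M_ (D nu.-1) l.-1 (E_ (D j) nu b))).
  apply: eq_big_nat => l lj; rewrite (M_next (op j0)); last by lia.
  by rewrite linear_sum subn1.
rewrite exchange_big_nat_le; apply: eq_big_nat => nu nuj.
rewrite (Sbar_next (op _)); [|by lia|by lia].
by rewrite big_add1.
Qed.

Lemma toeplitzM_next i j b : (2 <= i <= j)%N ->
  toeplitzM i j b =
    \sum_(i <= nu < j.+1) toeplitzM i.-1 nu.-1 (E_ (D j) nu b).
Proof.
move=> ij; rewrite /toeplitzM.
transitivity (\sum_(i <= l < j.+1) \sum_(l <= nu < j.+1)
    L (l - i)%N (M_ (D nu.-1) l.-1 (E_ (D j) nu b))).
  apply: eq_big_nat => l lj; rewrite (M_next (op _)); [|by lia|by lia].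
  by rewrite linear_sum.
rewrite exchange_big_nat_le; apply: eq_big_nat => nu nuj.
case: i nu => [|i] [|nu] in ij nuj *; try by lia.
by rewrite big_add1; apply: eq_big_nat => l _; rewrite subSS.
Qed.

Lemma toeplitzM_eq0 i j n :
  (2 <= i <= j)%N -> N_ (D j.-1) n -> toeplitzM i j n = 0.
Proof.
case: i => // i; elim: i j n => [|i IH] j n ij Nn; first by lia.
rewrite toeplitzM_next// big_nat_cond big1// => nu; rewrite andbT => nuj.
have NE : N_ (D nu.-1) (E_ (D j) nu n).
  have [->|nuj'] := eqVneq nu j; first by rewrite (E_diag (op _))//; lia.
  have [|NcE _] := @E_SinvP nu j n; first by lia.
  by apply: Nc_subset_N; rewrite prednK//; lia.
case: i IH ij nuj => [|i] IH ij nuj.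
  rewrite toeplitzM_first; last by lia.
  by move: NE; rewrite (N_def (op _)) => [[]|]//; lia.
by apply: IH; [lia|apply: N_decr NE; lia].
Qed.

Lemma toeplitz_M_sum i k (m : nat -> B) :
  \sum_(i <= l < k.+1) L (l - i)%N (\sum_(l <= j < k.+1) M_ (D j) l (m j)) =
  \sum_(i <= j < k.+1) toeplitzM i j (m j).
Proof.
under eq_bigr => l _ do rewrite linear_sum.
exact: exchange_big_nat_le.
Qed.

(* [b 1], ..., [b k] stand for b_{k-1}, ..., b_0. *)
Definition kernel_seq k (b : nat -> B) : Prop :=
  forall i, (1 <= i <= k)%N -> \sum_(i <= l < k.+1) L (l - i)%N (b l) = 0.

Lemma kernel_seqM k (m : nat -> B) :
  (forall j, (1 <= j <= k)%N -> N_ (D j) (m j)) ->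
  kernel_seq k (fun i => \sum_(i <= j < k.+1) M_ (D j) i (m j)).
Proof.
move=> Nm i ik; rewrite toeplitz_M_sum big_nat_cond big1// => j.
rewrite andbT => ij; have Nj : N_ (D j) (m j) by apply: Nm; lia.
have [i1|i1] := eqVneq i 1%N; last first.
  by apply: toeplitzM_eq0; [lia|apply: N_decr Nj; lia].
rewrite i1 toeplitzM_first; last by lia.
by move: Nj; rewrite (N_def (op _)) => [[]|]//; lia.
Qed.

(* M^{(k+1)} = diag(I_B, M^{(k)}) E^{(k+1)}, where E^{(k+1)} is unipotent and
   preserves N_0 x ... x N_k; the first row of the equation then reads
   S_1 m_1 + ... + S_{k+1} m_{k+1} = 0. *)
Lemma kernel_seq_inv k b : kernel_seq k b -> exists2 m : nat -> B,
  (forall j, (1 <= j <= k)%N -> N_ (D j) (m j)) &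
  forall i, (1 <= i <= k)%N -> b i = \sum_(i <= j < k.+1) M_ (D j) i (m j).
Proof.
elim: k b => [|k IH] b kb; first by exists (fun=> 0) => i; lia.
have [|n Nn bn] := IH (b \o S).
  move=> i ik; rewrite -[RHS](kb i.+1) ?big_add1; last by lia.
  by apply: eq_big_nat => l _; rewrite subSS.
pose c i := if i == 1%N then b 1%N else n i.-1.
have [m mE] : exists m : nat -> B, forall i, (i <= k.+1)%N ->
    m i = c i - \sum_(i.+1 <= nu < k.+2) E_ (D nu) i (m nu).
  pose Q i (f : nat -> B) x := x = c i - \sum_(i.+1 <= nu < k.+2) E_ (D nu) i (f nu).
  apply: (@back_recursion _ Q) => [i f f' x ff' ->|i f|]; last exact: 0.
    by congr (_ - _); apply: eq_big_nat => nu /andP[inu _]; rewrite ff'.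
  by eexists.
have cE i : (1 <= i <= k.+1)%N -> c i = \sum_(i <= nu < k.+2) E_ (D nu) i (m nu).
  move=> ik; rewrite big_ltn; last by lia.
  by rewrite (E_diag (op _)) ?mE ?subrK//; lia.
have Nm i : (1 <= i <= k.+1)%N -> N_ (D i.-1) (m i).
  move=> ik; have sN := subspace_N (Drec i.-1).
  rewrite mE; last by lia.
  apply: (subspaceB sN).
    rewrite /c; case: eqP => [->/=|i1]; last by apply: Nn; lia.
    by have [[-> _ _ _] _] := Drec 0.
  apply: (subspace_sum_nat sN) => nu inu.
  have [|NcE _] := @E_SinvP i nu (m nu); first by lia.
  by apply: Nc_subset_N; rewrite prednK//; lia.
have bE i : (1 <= i <= k.+1)%N -> b i = \sum_(i <= j < k.+2) M_ (D j) i (m j).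
  move=> ik; have [->|i1] := eqVneq i 1%N.
    rewrite -[LHS]/(c 1%N) cE//; apply: eq_big_nat => j jk.
    by rewrite (M_first (op _)); [|lia].
  have -> : b i = \sum_(i <= j < k.+2) M_ (D j.-1) i.-1 (c j).
    have -> : i = i.-1.+1 by lia.
    rewrite [LHS](bn i.-1); last by lia.
    rewrite [RHS]big_add1; apply: eq_big_nat => j ij /=; rewrite /c ifN//.
    by lia.
  transitivity (\sum_(i <= j < k.+2) \sum_(j <= nu < k.+2)
      M_ (D j.-1) i.-1 (E_ (D nu) j (m nu))).
    apply: eq_big_nat => j ij; rewrite cE ?linear_sum//; lia.
  rewrite exchange_big_nat_le; apply: eq_big_nat => nu nuk.
  by rewrite (M_next (op _)) //; lia.
have sum0 : \sum_(1 <= j < k.+2) S_ (D j) (m j) + 0 = 0.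
  rewrite addr0 -[RHS](kb 1%N)// [RHS](eq_big_nat _ _
    (F2 := fun l => L (l - 1)%N (\sum_(l <= j < k.+2) M_ (D j) l (m j)))).
    rewrite toeplitz_M_sum; apply: eq_big_nat => j jk.
    by rewrite toeplitzM_first//; lia.
  by move=> l lk; rewrite bE//; lia.
exists m => // j jk.
have [_ sRc _ ind] := recursion_decomposesR (Drec k.+1).
have [||r0 _] := ind (fun j => S_ (D j) (m j)) 0 _ _ sum0.
- move=> i ik; rewrite (R_def (op _)); last by lia.
  by exists (m i) => //; apply: Nm.
- exact: sRc.1.
rewrite (N_def (op _)); last by lia.
by split; [exact: Nm|exact: r0].
Qed.

Lemma M_seq_inj k (m : nat -> B) :
  (forall i, (1 <= i <= k)%N -> \sum_(i <= j < k.+1) M_ (D j) i (m j) = 0) ->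
  forall j, (1 <= j <= k)%N -> m j = 0.
Proof.
elim: k => [|k IH] Mm0 j jk; first by lia.
have mk : m k.+1 = 0.
  by have := Mm0 k.+1; rewrite big_nat1 M_diagE// leqnn; apply.
have [->//|jk'] := eqVneq j k.+1.
apply: IH; last by lia.
move=> i ik; rewrite -[RHS](Mm0 i); last by lia.
rewrite [RHS]big_nat_recr/=; last by lia.
by rewrite mk linear0 addr0.
Qed.

Lemma upper_triangular_sum (V W : lmodType K) k (f : nat -> {linear V -> W}) i
    (b : {ffun 'I_k.+1 -> V}) :
  \sum_(j < k.+1) (if (i <= j)%N then f j.+1 else \0 : {linear V -> W}) (b j) =
  \sum_(i.+1 <= l < k.+2) f l (b (inord l.-1)).
Proof.
rewrite big_add1 /= big_geq_mkord [RHS]big_mkcond /=; apply: eq_bigr => j _.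
by case: ifP; rewrite // inord_val.
Qed.

Lemma toeplitz_kernel k (b : {ffun 'I_k.+1 -> B}) :
  toeplitz L k.+1 b = 0 <-> kernel_seq k.+1 (fun i => b (inord i.-1)).
Proof.
have tE (i : 'I_k.+1) : toeplitz L k.+1 b i =
    \sum_(i.+1 <= l < k.+2) L (l - i.+1)%N (b (inord l.-1)).
  rewrite ffunE -(upper_triangular_sum (fun l => L (l - i.+1)%N)).
  by apply: eq_bigr => j _; rewrite subSS.
split=> [b0 i ik|kb]; last first.
  by apply/ffunP => i; rewrite tE kb ?ffunE//= ltn_ord.
have ik' : (i.-1 < k.+1)%N by lia.
by have := tE (Ordinal ik'); rewrite b0 ffunE /= prednK => [<-//|]; lia.
Qed.

Lemma M_mxE k (n : {ffun 'I_k.+1 -> B}) (i : 'I_k.+1) :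
  M_mx D k.+1 n i =
    \sum_(i.+1 <= j < k.+2) M_ (D j) i.+1 (n (inord j.-1)).
Proof. by rewrite ffunE -(upper_triangular_sum (fun l => M_ (D l) i.+1)). Qed.

Lemma M_mx_last k (n : {ffun 'I_k.+1 -> B}) :
  M_mx D k.+1 n ord_max = n ord_max.
Proof.
rewrite M_mxE big_nat1 M_diagE//=; congr (n _).
by apply: val_inj; rewrite /= inordK.
Qed.

Lemma toeplitz_kernelE k :
  toeplitz L k.+1 @^-1` [set 0] =
    M_mx D k.+1 @` [set n : {ffun 'I_k.+1 -> B} |
                      forall i : 'I_k.+1, N_ (D i.+1) (n i)].
Proof.
have nE (m : nat -> B) j : (1 <= j < k.+2)%N ->
    [ffun i : 'I_k.+1 => m i.+1] (inord j.-1) = m j.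
  by move=> jk; rewrite ffunE inordK ?prednK//; lia.
apply/seteqP; split=> [b /toeplitz_kernel/kernel_seq_inv[m Nm bm]|_ [n Nn <-]].
  exists [ffun i : 'I_k.+1 => m i.+1] => [i|].
    by rewrite ffunE; apply: Nm; rewrite /= ltn_ord.
  apply/ffunP => i; rewrite M_mxE -[in RHS](inord_val i) [RHS](bm i.+1).
    by apply: eq_big_nat => j ij; rewrite nE//; lia.
  by rewrite /= ltn_ord.
apply/toeplitz_kernel => i ik.
have Nn' j : (1 <= j <= k.+1)%N -> N_ (D j) (n (inord j.-1)).
  by move=> jk; have := Nn (inord j.-1); rewrite inordK ?prednK//; lia.
rewrite -[RHS](kernel_seqM Nn' ik); apply: eq_big_nat => l il.
by rewrite M_mxE inordK ?prednK//; lia.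
Qed.

End Kernel.

Section Rank.
Context {K : fieldType} {B Bbar : lmodType K} {L : nat -> {linear B -> Bbar}}.
Context {D : nat -> stage B Bbar}.
Context (Drec : forall k, recursion L D k).

Let op j (j0 : (0 < j)%N) : stage_operators L D j.
Proof. by have [] := recursion_stage j0 (Drec j). Qed.

Lemma M_colE k j n (i : 'I_k) : (0 < j)%N ->
  M_col D k j n i = if (i < j)%N then M_ (D j) i.+1 n else 0.
Proof.
move=> j0; rewrite ffunE; case: (ltngtP i.+1 j) => // ij.
by rewrite -ij (M_diagE Drec).
Qed.

Lemma subspace_M_col k j : (0 < j)%N -> subspace (M_col D k j @` N_ (D j)).
Proof.
move=> j0; have /linear_eqfun[g /funext <-] : linear (M_col D k j).
  move=> a u v; apply/ffunP => i; rewrite !ffunE.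
  by case: ifP => _; [rewrite linearP|case: ifP => _; rewrite ?scaler0 ?addr0].
by apply: subspace_image; apply: subspace_N (Drec j).
Qed.

Lemma sum_M_col k (m : nat -> B) (i : 'I_k) :
  (\sum_(1 <= j < k.+1) M_col D k j (m j)) i =
  \sum_(i.+1 <= j < k.+1) M_ (D j) i.+1 (m j).
Proof.
rewrite sum_ffunE (@big_nat_widenl _ _ _ i.+1 1)// [RHS]big_mkcond /=.
by apply: eq_big_nat => j jk; rewrite M_colE//; lia.
Qed.

Lemma M_mx_sum_col k (n : {ffun 'I_k.+1 -> B}) :
  M_mx D k.+1 n = \sum_(1 <= j < k.+2) M_col D k.+1 j (n (inord j.-1)).
Proof. by apply/ffunP => i; rewrite M_mxE sum_M_col. Qed.

Lemma toeplitz_kernel_direct_sum k :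
  direct_sum [seq M_col D k.+1 j @` N_ (D j) | j <- iota 1 k.+1]
    (toeplitz L k.+1 @^-1` [set 0]).
Proof.
have col (r : nat -> {ffun 'I_k.+1 -> B}) :
    (forall i, (1 <= i <= k.+1)%N -> (M_col D k.+1 i @` N_ (D i)) (r i)) ->
    exists m : nat -> B, forall i, (1 <= i <= k.+1)%N ->
      N_ (D i) (m i) /\ r i = M_col D k.+1 i (m i).
  move=> rcol; have [//|m mP] := @choice _ _ (fun i n => (1 <= i <= k.+1)%N ->
    N_ (D i) n /\ r i = M_col D k.+1 i n); last by exists m.
  move=> i; have [/rcol[n Nn <-]|_] := boolP (1 <= i <= k.+1)%N; last by exists 0.
  by exists n.
apply/direct_sum_iotaP; split.
- by move=> i /andP[i0 _]; apply: subspace_M_col.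
- move=> v; rewrite (toeplitz_kernelE Drec); split=> [[n Nn <-]|].
    exists (fun j => M_col D k.+1 j (n (inord j.-1))); last exact: M_mx_sum_col.
    move=> j jk; exists (n (inord j.-1)) => //.
    by have := Nn (inord j.-1); rewrite inordK ?prednK//; lia.
  move=> [r /col[m mP] ->]; exists [ffun i : 'I_k.+1 => m i.+1].
    by move=> i; rewrite ffunE; apply: (mP _ _).1; rewrite /= ltn_ord.
  rewrite M_mx_sum_col; apply: eq_big_nat => j jk.
  by rewrite (mP _ jk).2 ffunE inordK ?prednK//; lia.
- move=> r /col[m mP]; rewrite (@eq_big_nat _ _ _ 1 k.+2 _ _ (fun i ik => (mP i ik).2)).
  move=> /ffunP rm0 i ik; have [_ ->] := mP i ik.
  have -> : m i = 0.
    apply: (M_seq_inj Drec _ ik) => l lk.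
    have lk' : (l.-1 < k.+1)%N by lia.
    have := rm0 (Ordinal lk'); rewrite sum_M_col ffunE /= prednK//; lia.
  apply/ffunP => l; rewrite M_colE ?linear0 ?ffunE ?if_same//; lia.
Qed.

Lemma toeplitz_kernel_last k b0 :
  (exists b : {ffun 'I_k.+1 -> B},
     (forall i : 'I_k.+1, i = k :> nat -> b i = b0) /\ toeplitz L k.+1 b = 0)
  <-> N_ (D k.+1) b0.
Proof.
split=> [[b [bl bker]]|Nb0].
  have : (toeplitz L k.+1 @^-1` [set 0]) b by [].
  rewrite (toeplitz_kernelE Drec) -(bl ord_max)// => -[n Nn <-].
  by rewrite (M_mx_last Drec); apply: (Nn ord_max).
pose n : {ffun 'I_k.+1 -> B} := [ffun i => if i == ord_max then b0 else 0].
exists (M_mx D k.+1 n); split=> [i ik|].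
  have -> : i = ord_max by apply: val_inj.
  by rewrite (M_mx_last Drec) ffunE eqxx.
have : (toeplitz L k.+1 @^-1` [set 0]) (M_mx D k.+1 n) => //.
rewrite (toeplitz_kernelE Drec); exists n => // i; rewrite ffunE.
case: eqP => [->//|_]; exact: (subspace_N (Drec _)).1.
Qed.

(** * Rank and stabilization *)

Context (RR : realType).

Lemma N1E b0 : N_ (D 1%N) b0 <-> L 0%N b0 = 0.
Proof.
have [[N0 _ _ _] _] := Drec 0.
rewrite (N_def (op (ltn0Sn 0))) /= N0; split=> [[_]|L0]; last split=> //.
  by rewrite (S_first (op _)).
by rewrite (S_first (op _)).
Qed.

Lemma rankE b0 : N_ (D 1%N) b0 ->
  rank RR L b0 =
    ereal_sup [set (k%:R)%:E | k in [set k : nat | (1 <= k)%N /\ N_ (D k) b0]].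
Proof.
move=> /N1E L0; rewrite /rank L0 eqxx; congr ereal_sup.
rewrite eqEsubset; split=> _ [k [k0 Nk] <-]; exists k => //; split=> //.
  by case: k k0 Nk => // k _ /toeplitz_kernel_last.
by case: k k0 Nk => // k _ /toeplitz_kernel_last.
Qed.

Lemma rank_ge0 b0 : (0 <= rank RR L b0)%E.
Proof.
have [N1|N1] := pselect (N_ (D 1%N) b0); last first.
  by rewrite /rank ifN//; apply/eqP => /N1E.
rewrite rankE//; apply: (@le_trans _ _ 1%:R%:E); first by rewrite lee_fin ler01.
by apply: ereal_sup_ubound; exists 1%N.
Qed.

Lemma rank_le k b0 : ~ N_ (D k.+1) b0 -> (rank RR L b0 <= k%:R%:E)%E.
Proof.
move=> nN; have [N1|N1] := pselect (N_ (D 1%N) b0); last first.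
  by rewrite /rank ifN ?lee_fin// ; apply/eqP => /N1E.
rewrite rankE//; apply: ub_ereal_sup => _ [j [_ Nj] <-].
rewrite lee_fin ler_nat leqNgt; apply/negP => kj; apply: nN.
exact: (N_decr Drec kj).
Qed.

Lemma rank_geP k b0 : (k%:R%:E <= rank RR L b0)%E <-> N_ (D k) b0.
Proof.
split; case: k => [|k].
- by have [[-> _ _ _] _] := Drec 0.
- move=> kr; apply: contrapT => /rank_le/(le_trans kr).
  by rewrite lee_fin ler_nat ltnn.
- by move=> _; apply: rank_ge0.
- move=> Nk; rewrite rankE; last exact: (N_decr Drec (ltn0Sn k)).
  by apply: ereal_sup_ubound; exists k.+1.
Qed.

Lemma rank_eqP k b0 :
  rank RR L b0 = k%:R%:E <-> (N_ (D k) `\` N_ (D k.+1)) b0.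
Proof.
split=> [rk|[Nk nN]].
  split; first by apply/rank_geP; rewrite rk.
  by move=> /rank_geP; rewrite rk lee_fin ler_nat ltnn.
by apply/eqP; rewrite eq_le rank_le//=; apply/rank_geP.
Qed.

Lemma rank_infty b0 : rank RR L b0 = +oo%E <-> forall k, N_ (D k) b0.
Proof.
split=> [rb k|Nb]; first by apply/rank_geP; rewrite rb leey.
apply/eqyP => x /ltW/archi_boundP/ltW x0.
by apply: (@le_trans _ _ (Num.bound x)%:R%:E); [rewrite lee_fin|exact/rank_geP].
Qed.

Lemma stabilizes_atP k : stabilizes_at RR L k <->
  N_ (D k.+1) `<` N_ (D k) /\
  (forall l, (2 <= l)%N -> N_ (D k.+1) = N_ (D (k + l)%N)).
Proof.
split=> [[rk [b0 /rank_eqP[Nb0 nNb0]]]|[[_ Nk] Nl]].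
  split=> [|l l2].
    by split; [apply: (N_decr Drec)|move=> /(_ _ Nb0)].
  apply/seteqP; split=> [b Nb|]; last by apply: (N_decr Drec); lia.
  have [[m mk /rank_eqP[_ []]]|/rank_infty//] := rk b.
  exact: (N_decr Drec _ Nb).
split=> [b|]; last first.
  have [b [Nb nNb]] : exists b, (N_ (D k) `\` N_ (D k.+1)) b.
    apply: contrapT => nb; apply: Nk => b Nb; apply: contrapT => nNb.
    by apply: nb; exists b.
  by exists b; apply/rank_eqP.
have [Nb|nNb] := pselect (N_ (D k.+1) b).
  right; apply/rank_infty => j; have [jk|kj] := leqP j k.+1.
    exact: (N_decr Drec jk).
  have -> : j = (k + (j - k))%N by lia.
  by rewrite -Nl//; lia.
left; elim: k {Nk Nl} nNb => [|k IH] nNb.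
  by exists 0%N => //; apply/rank_eqP; split=> //; have [[-> _ _ _] _] := Drec 0.
have [Nk|/IH[m mk ?]] := pselect (N_ (D k.+1) b); last by exists m => //; lia.
by exists k.+1 => //; apply/rank_eqP.
Qed.

Lemma Nc_eq0P k : Nc_ (D k.+1) = [set 0] <-> N_ (D k.+1) = N_ (D k).
Proof.
have [_ [/direct_sum2P[sNc sN NE Nc0] _] _ _] := recursion_stage (ltn0Sn k) (Drec _).
split=> [NcE|NN].
  apply/seteqP; split=> [|n /NE[x [w [+ Nw ->]]]]; first exact: (N_decr Drec).
  by rewrite NcE => ->; rewrite add0r.
apply/seteqP; split=> [n Ncn|_ ->]; last exact: sNc.1.
by apply: Nc0 => //; rewrite NN; apply: (Nc_subset_N Drec).
Qed.

Lemma R_eq0P k : R_ (D k.+1) = [set 0] <-> N_ (D k.+1) = N_ (D k).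
Proof.
rewrite (R_def (op (ltn0Sn k))) (N_def (op (ltn0Sn k))) /=.
split=> [SE|NE].
  apply/seteqP; split=> [n []//|n Nn]; split=> //.
  have : (S_ (D k.+1) @` N_ (D k)) (S_ (D k.+1) n) by exists n.
  by rewrite SE.
apply/seteqP; split=> [_ [n + <-]|_ ->]; first by rewrite -NE => -[].
by exists 0; [exact: (subspace_N (Drec k)).1|rewrite linear0].
Qed.

Lemma stabilizes_at_eq0P (V : lmodType K) (A : nat -> set V) k :
  (forall j, A j.+1 = [set 0] <-> N_ (D j.+1) = N_ (D j)) ->
  stabilizes_at RR L k <->
  A k.+1 <> [set 0] /\ (forall l, (2 <= l)%N -> A (k + l)%N = [set 0]).
Proof.
move=> A0P; rewrite stabilizes_atP A0P; split=> -[Nk Nl]; split.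
- by move=> NN; move: Nk; rewrite NN => /properxx.
- case=> // l l1; rewrite addnS A0P -addnS -Nl//.
  have [->|l1'] := eqVneq l 1%N; first by rewrite addn1.
  by apply: Nl; lia.
- split; first exact: (N_decr Drec).
  by move=> NN; apply: Nk; apply/seteqP; split=> //; apply: (N_decr Drec).
- case=> // l; elim: l => // l IH l2.
  rewrite addnS (A0P (k + l.+1)%N).1; last by rewrite -addnS; apply: Nl.
  by have [->|l1] := eqVneq l 0%N; [rewrite addn1|apply: IH; lia].
Qed.

End Rank.

Theorem lemma1 (RR : realType) (F : scalar_kind)
    (B Bbar : lmodType (scalars RR F)) (L : nat -> {linear B -> Bbar})
    (L_neq0 : exists i b, L i b <> 0) :
  (* the recursion is well defined at every stage k+1 *)
  (forall (k : nat) (D : nat -> stage B Bbar), recursion L D k ->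
     (exists D' : nat -> stage B Bbar,
        (forall j, (j <= k)%N -> D' j = D j) /\ stage_operators L D' k.+1) /\
     (stage_operators L D k.+1 ->
        [/\ (forall b, Rc_ (D k) (S_ (D k.+1) b)),
            (forall b, M_ (D k.+1) k.+1 b = b),
            (exists Nc Rc, complements D k.+1 Nc Rc)
          & complements D k.+1 (Nc_ (D k.+1)) (Rc_ (D k.+1)) ->
            [/\ direct_sum (rcons [seq Nc_ (D i) | i <- iota 1 k.+1]
                              (N_ (D k.+1))) setT,
                direct_sum (rcons [seq R_ (D i) | i <- iota 1 k.+1]
                              (Rc_ (D k.+1))) setT,
                (exists p : {linear Bbar -> Bbar},
                   is_projection D k.+1 p /\
                   forall p' : Bbar -> Bbar,
                     is_projection D k.+1 p' -> p' =1 p),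
                set_bij (Nc_ (D k.+1)) (R_ (D k.+1)) (S_ (D k.+1))
              & exists s : Bbar -> B, is_inverse D k.+1 s]])) /\
  (* for any choice of complements *)
  (forall D : nat -> stage B Bbar, (forall k, recursion L D k) ->
     [/\ (* (i) *)
         (forall k : nat,
            toeplitz L k.+1 @^-1` [set 0] =
              M_mx D k.+1 @` [set n : {ffun 'I_k.+1 -> B} |
                                forall i : 'I_k.+1, N_ (D i.+1) (n i)] /\
            direct_sum [seq M_col D k.+1 j @` N_ (D j) | j <- iota 1 k.+1]
              (toeplitz L k.+1 @^-1` [set 0])),
         (* (ii) *)
         (forall (k : nat) (b0 : B),
            [/\ (k%:R%:E <= rank RR L b0)%E <-> N_ (D k) b0,
                rank RR L b0 = k%:R%:E <-> (N_ (D k) `\` N_ (D k.+1)) b0,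
                Nc_ (D k.+1) `<=` N_ (D k)
              & Nc_ (D k.+1) b0 -> b0 <> 0 -> rank RR L b0 = k%:R%:E])
       & (* (iii) *)
         (forall k : nat,
            [/\ stabilizes_at RR L k <->
                  Nc_ (D k.+1) <> [set 0] /\
                  (forall l, (2 <= l)%N -> Nc_ (D (k + l)%N) = [set 0]),
                stabilizes_at RR L k <->
                  R_ (D k.+1) <> [set 0] /\
                  (forall l, (2 <= l)%N -> R_ (D (k + l)%N) = [set 0])
              & stabilizes_at RR L k <->
                  N_ (D k.+1) `<` N_ (D k) /\
                  (forall l, (2 <= l)%N -> N_ (D k.+1) = N_ (D (k + l)%N))])]).
Proof.
split=> [k D Dk|D Drec].
  split; first exact: stage_exists Dk.
  move=> opk; split.
  - by move=> b; apply: S_range Dk opk.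
  - by move=> b; apply: M_diag Dk opk.
  - exact: complements_exist Dk opk.
  move=> Ck; have [CN CR] := Ck.
  have dN := decomposesS (recursion_decomposesN Dk) CN.
  have dR := decomposesS (recursion_decomposesR Dk) CR.
  have Sbij := S_bij opk Ck.
  split=> //.
  - exact: (decomposes_direct_sum dN).
  - exact: (decomposes_direct_sum dR).
  - exact: (projection_exists (ltn0Sn k) dR).
  - exact: (inverse_exists Sbij).
split=> [k|k b0|k].
- by split; [exact: toeplitz_kernelE|exact: toeplitz_kernel_direct_sum].
- split; [exact: rank_geP|exact: rank_eqP|exact: Nc_subset_N|].
  move=> Ncb b_neq0; apply/(rank_eqP Drec); split; first exact: (Nc_subset_N Drec).
  by move=> Nb; apply: b_neq0; apply: (Nc_N_eq0 Drec Ncb).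
- split.
  + exact: (stabilizes_at_eq0P (A := fun j => Nc_ (D j)) Drec RR k (Nc_eq0P Drec)).
  + exact: (stabilizes_at_eq0P (A := fun j => R_ (D j)) Drec RR k (R_eq0P Drec)).
  + exact: (stabilizes_atP Drec).
Qed.
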